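(* Let $P$ be a polynomial in $d$ variables with constant coefficients from $\mathbb{C}$, let $x_0\in\mathbb{C}^d$, let $l\in\mathbb{Z}_{\ge 0}$, and let $v\in\mathbb{C}^{\tilde d(l)}$ be such that the function $e^{i x_0\cdot x}\,[\widetilde{\mathcal{P}}_l(x)]\,v$ is non-zero. Then this function belongs to $\ker P(-iD)$ if and only if $P(x_0)=0$ and $v\in\ker\widetilde{\mathbf{D}}_l P(x_0)$.
   Context: Here $d\in\mathbb{N}$ and $x\cdot y=x_1y_1+\cdots+x_dy_d$. For $k\in\mathbb{Z}_{\ge0}$, $\mathcal{A}_k$ is the list of all multi-indices $\alpha\in\mathbb{Z}_{\ge0}^d$ of length $|\alpha|=\alpha_1+\dots+\alpha_d=k$, ordered by a fixed lexicographical order; it has $d(k)=\binom{d+k-1}{k}$ elements. $\widetilde{\mathcal{A}}_l=(\mathcal{A}_0,\dots,\mathcal{A}_l)$ is the concatenated list, of length $\tilde d(l)=\frac{(d+l)!}{l!\,d!}$. $[\widetilde{\mathcal{P}}_l(x)]$ is the row vector of monomials $x^\alpha$, $\alpha$ running through $\widetilde{\mathcal{A}}_l$ in order. Write $\beta\le\alpha$ if $\beta_s\le\alpha_s$ for all $s$; $\binom{\alpha}{\beta}=\prod_s\binom{\alpha_s}{\beta_s}$; $D^\gamma=D_1^{\gamma_1}\cdots D_d^{\gamma_d}$ with $D_n$ the partial derivative in the $n$th coordinate. $\widetilde{\mathbf{D}}_lP(x_0)$ is the $\tilde d(l)\times\tilde d(l)$ matrix with rows and columns indexed by $\widetilde{\mathcal{A}}_l$,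 whose entry in row $\beta$ and column $\alpha$ is $(-i)^{|\alpha-\beta|}\binom{\alpha}{\beta}D^{\alpha-\beta}P(x_0)$ if $\beta\le\alpha$, and $0$ otherwise. $\ker$ of a matrix is its right null-space over $\mathbb{C}$. $P(-iD)$ is the constant coefficient differential operator obtained by substituting $-iD_n$ for the $n$th variable of $P$; $\ker P(-iD)$ is its null-space. *)

(* Defs.v *)
From HB Require Import structures.
From mathcomp Require Import all_boot all_order all_algebra.
From mathcomp Require Import boolp classical_sets functions reals topology sequences.
From mathcomp Require Import normedtype derive exp trigo.
From mathcomp Require Import complex.
(* The notations of mpoly.v conflict with those of MathComp-Analysis. *)
From mathcomp Require Import -(notations) mpoly.

Set Implicit Arguments.
Unset Strict Implicit.
Unset Printing Implicit Defensive.

Import Order.TTheory GRing.Theory Num.Theory.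
Import numFieldNormedType.Exports.

Local Open Scope ring_scope.
Local Open Scope classical_set_scope.
Local Open Scope complex_scope.

Section MultiIndices.
Variable d : nat.

(* The library order on [multinom d] compares total degrees first, then the
   coordinates lexicographically; at fixed degree it is the lexicographic
   order. *)
Definition multi_indices (k : nat) : seq (multinom d) :=
  sort <=%O [seq a <- map (@bmnm d k.+1) (enum {: bmultinom d k.+1})
            | mdeg a == k].

Definition multi_indices_upto (l : nat) : seq (multinom d) :=
  flatten [seq multi_indices k | k <- iota 0 l.+1].

Definition tdim (l : nat) : nat := ((d + l)`! %/ (l`! * d`!))%N.

(* The default value of [nth] is never reached: see [size_multi_indices_upto]. *)
Definition multi_index (l : nat) (j : 'I_(tdim l)) : multinom d :=
  nth mnm0 (multi_indices_upto l) j.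

Lemma mem_multi_indices k a : (a \in multi_indices k) = (mdeg a == k).
Proof.
rewrite mem_sort mem_filter; case: eqP => //= <-.
by apply/mapP; exists (BMultinom (ltnSn (mdeg a))); rewrite ?mem_enum.
Qed.

Lemma uniq_multi_indices k : uniq (multi_indices k).
Proof.
by rewrite sort_uniq filter_uniq // map_inj_uniq ?enum_uniq //; exact: val_inj.
Qed.

Lemma mem_multi_indices_upto l a :
  (a \in multi_indices_upto l) = (mdeg a <= l)%N.
Proof.
apply/flatten_mapP/idP => [[k]|al].
  by rewrite mem_iota ltnS mem_multi_indices => /andP[_ kl] /eqP ->.
by exists (mdeg a); rewrite ?mem_iota ?ltnS ?mem_multi_indices ?eqxx.
Qed.

End MultiIndices.

Lemma size_multi_indices d k : (0 < d)%N ->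
  size (multi_indices d k) = 'C((d + k).-1, k).
Proof.
case: d => // n _; rewrite addSn /= addnC -size_basis; apply: perm_size.
apply: uniq_perm; rewrite ?uniq_multi_indices ?uniq_basis // => a.
by rewrite mem_multi_indices basis_cover.
Qed.

Lemma size_multi_indices_upto d l : (0 < d)%N ->
  size (multi_indices_upto d l) = tdim d l.
Proof.
move=> d0.
have -> : tdim d l = 'C(d + l, l).
  by rewrite /tdim bin_factd ?addn_gt0 ?d0 // addnK.
rewrite /multi_indices_upto; elim: l => [|l IH].
  by rewrite /= cats0 size_multi_indices // !bin0.
rewrite -[l.+2]addn1 iotaD map_cat flatten_cat size_cat IH /= cats0.
by rewrite size_multi_indices // add0n !addnS binS addnC.
Qed.

Section ExponentialPolynomials.
Variables (R : realType) (d : nat).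
Local Notation C := R[i].
Implicit Types (x : 'rV[R]_d) (f : 'rV[R]_d -> C).
Implicit Type P : mpoly d C.

Definition cexp (z : C) : C :=
  (expR (complex.Re z))%:C * (cos (complex.Im z) +i* sin (complex.Im z)).

Definition dotp (x0 : 'rV[C]_d) x : C := \sum_(s < d) x0 0 s * (x 0 s)%:C.

Definition monomials (l : nat) x : 'rV[C]_(tdim d l) :=
  \row_j \prod_(s < d) (x 0 s)%:C ^+ multi_index j s.

Definition exp_poly (x0 : 'rV[C]_d) (l : nat) (v : 'cV[C]_(tdim d l)) :
    'rV[R]_d -> C := fun x =>
  cexp ('i%C * dotp x0 x) * (monomials l x *m v) 0 0.

Definition partialC (n : 'I_d) f : 'rV[R]_d -> C := fun x =>
  let e : 'rV[R]_d := delta_mx 0 n in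
  'D_e (fun y => complex.Re (f y)) x +i* 'D_e (fun y => complex.Im (f y)) x.

(* Total differentiability of all iterated partial derivatives; their mere
   existence would not imply that f is continuous. *)
Definition smooth f : Prop := forall (s : seq 'I_d) x,
  let g := foldr partialC f s in
  differentiable (fun y => complex.Re (g y)) x /\
  differentiable (fun y => complex.Im (g y)) x.

Definition minus_iD (n : 'I_d) f : 'rV[R]_d -> C :=
  fun x => - 'i%C * partialC n f x.

Definition minus_iD_monomial (a : multinom d) f : 'rV[R]_d -> C :=
  foldr (fun n => iter (a n) (minus_iD n)) f (enum 'I_d).

Definition P_minus_iD P f : 'rV[R]_d -> C :=
  fun x => \sum_(a <- msupp P) mcoeff a P * minus_iD_monomial a f x.

Definition ker_P_minus_iD P : set ('rV[R]_d -> C) :=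
  [set f | smooth f /\ P_minus_iD P f = cst 0].

Definition peval P (x0 : 'rV[C]_d) : C := meval (x0 0) P.

Definition Dtilde (l : nat) P (x0 : 'rV[C]_d) : 'M[C]_(tdim d l) :=
  \matrix_(j, k)
    let b := multi_index j in
    let a := multi_index k in
    if lem b a then
      (- 'i%C) ^+ mdeg (mnm_sub a b) * (\prod_(s < d) 'C(a s, b s))%:R
        * peval (mderivm (mnm_sub a b) P) x0
    else 0.

End ExponentialPolynomials.

(* Main.v *)
Require Import Defs.
From HB Require Import structures.
From mathcomp Require Import all_boot all_order all_algebra.
From mathcomp Require Import boolp classical_sets functions reals topology sequences.
From mathcomp Require Import normedtype derive exp trigo.
From mathcomp Require Import complex ring.
From mathcomp Require Import -(notations) mpoly.

Set Implicit Arguments.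
Unset Strict Implicit.
Unset Printing Implicit Defensive.

Import Order.TTheory GRing.Theory Num.Theory.
Import numFieldNormedType.Exports.

Local Open Scope ring_scope.
Local Open Scope classical_set_scope.
Local Open Scope complex_scope.

(** Write the function as f_q := e^{i x0.x} q(x) with q the polynomial whose
  coefficient at the j-th multi-index is v_j. Differentiation acts on such
  functions by D_n f_q = f_(i x0_n q + D_n q) ([partialC_exp_mpoly]), so f_q is
  smooth and P(-iD) f_q = f_r with r := P(x0 - iD) q, where P(x0 - iD) acts
  on polynomials ([P_minus_iD_exp_mpoly]). A function f_r vanishes only if
  r = 0: all its derivatives vanish, hence so do those of r at the origin
  ([exp_mpoly_eq0]). So f_q lies in the kernel of P(-iD) exactly when r = 0,
  and what remains is algebra: the coefficients of r are the entries of
  Dtilde l P x0 *m v ([mcoeff_shiftDPX]).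

  This last fact is proved for any operator P(c + tD). By the commutator rule
  [c_n + t D_n, X_n] = t, moving a factor X_n through P(c + tD) costs
  t (D_n P)(c + tD); therefore the constant coefficient of P(c + tD) X^g is
  t^|g| (D^g P)(c) ([mcoeff0_shiftDPX]). The coefficient at any b follows, as b!
  times it is the constant coefficient after applying D^b, which commutes with
  P(c + tD).

  The condition P(x0) = 0 follows from Dtilde l P x0 *m v = 0 because v <> 0:
  the row of b has non-zero entries only in columns above b and P(x0) on the
  diagonal, so for b of maximal degree with v_b <> 0 it reads P(x0) v_b = 0
  ([Dtilde_ker_root]). *)

(** * Multi-indices and polynomials *)

Lemma mnm_ind d (Q : multinom d -> Prop) :
  Q mnm0 -> (forall a k, Q a -> Q (mnm_add a (mnm1 k))) -> forall a, Q a.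
Proof.
move=> Q0 QS a; move: {2}(mdeg a) (erefl (mdeg a)) => m.
elim: m a => [|m IH] a am; first by move/eqP: am; rewrite mdeg_eq0 => /eqP ->.
have [k ak] : exists k, lem (mnm1 k) a.
  case: (pselect (exists k, a k != 0%N)) => [[k ak]|a0].
    by exists k; rewrite lep1mP.
  suff a_eq0 : a = mnm0 by rewrite a_eq0 mdeg0 in am.
  apply/mnmP => i; rewrite mnm0E; apply/eqP/negPn/negP => ai.
  by apply: a0; exists i.
rewrite -(submK ak); apply/QS/IH/eqP; rewrite -eqSS -am.
by rewrite -{2}(submK ak) mdegD mdeg1 addn1.
Qed.

Lemma submm d (a : multinom d) : mnm_sub a a = mnm0.
Proof. by rewrite -[X in mnm_sub X _]add0m addmK. Qed.

Lemma mdeg_lem d (a b : multinom d) : lem b a -> (mdeg b <= mdeg a)%N.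
Proof. by move=> ba; rewrite -(submK ba) mdegD leq_addl. Qed.

Lemma lem_mdeg_eq d (a b : multinom d) :
  lem b a -> (mdeg a <= mdeg b)%N -> a = b.
Proof.
move=> ba; rewrite -{1}(submK ba) mdegD -[leqRHS]add0n leq_add2r leqn0 mdeg_eq0.
by move=> /eqP ab0; rewrite -(submK ba) ab0 add0m.
Qed.

Lemma prod_ffact_bin d (a b : multinom d) :
  (\prod_(i < d) a i ^_ b i =
   (\prod_(i < d) 'C(a i, b i)) * \prod_(i < d) (b i)`!)%N.
Proof. by rewrite -big_split; apply: eq_bigr => i _; rewrite /= bin_ffact. Qed.

Lemma prod_bin_eq0 d (a b : multinom d) :
  ~~ lem b a -> (\prod_(i < d) 'C(a i, b i) = 0)%N.
Proof.
apply: contraNeq; rewrite -lt0n => prod_gt0; apply/mnm_lepP => i.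
by move: prod_gt0; rewrite (bigD1 i) //= muln_gt0 bin_gt0 => /andP[].
Qed.

Lemma meval_at0 d (K : comNzRingType) (c : 'I_d -> K) (p : mpoly d K) :
  c =1 (fun=> 0) -> meval c p = mcoeff mnm0 p.
Proof.
move=> c0; rewrite [p]mpolyE !raddf_sum; apply: eq_bigr => a _ /=.
rewrite mevalZ mcoeffZ; congr (_ * _).
elim/mnm_ind: a => [|a n _]; first by rewrite mpolyX0 meval1 rmorph1.
rewrite mpolyXD mevalM mevalXU c0 mulr0 rmorphM /=.
by rewrite [mcoeff _ (mpolyX K (mnm1 n))]mcoeffX -mdeg_eq0 mdeg1 mulr0.
Qed.

(** * The operator P(c + tD) on polynomials *)

Section ShiftedDerivatives.
Variables (d : nat) (K : comNzRingType) (c : 'I_d -> K) (t : K).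
Implicit Types (p q : mpoly d K) (a b g : multinom d).

Local Notation "'X_ n" := (mpolyX K (mnm1 n)) (at level 8, n at level 2).

(** For c = x0 and t = - i this is what - i D_n becomes on the polynomial factor
  of e^{i x0.x} q(x). *)
Definition shiftD n q : mpoly d K := c n *: q + t *: mderiv n q.

Definition shiftDm a q : mpoly d K :=
  foldr (fun n => iter (a n) (shiftD n)) q (enum 'I_d).

Lemma shiftDC m n q : shiftD m (shiftD n q) = shiftD n (shiftD m q).
Proof.
rewrite /shiftD !(mderivD, mderivZ) mderiv_comm !scalerDr !scalerA.
by rewrite (mulrC (c m)) (mulrC (c m) t) (mulrC (c n) t) addrACA.
Qed.

Lemma shiftDm0 q : shiftDm mnm0 q = q.
Proof. by rewrite /shiftDm; elim: (enum _) => //= n s ->; rewrite mnm0E. Qed.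

(** The product of the factors c_n + t D_n is taken in the order of the
  coordinates; as they commute, a new factor may be put in front. *)
Lemma shiftDmU a k q : shiftDm (mnm_add a (mnm1 k)) q = shiftD k (shiftDm a q).
Proof.
rewrite /shiftDm.
have : k \in enum 'I_d by rewrite mem_enum.
elim: (enum _) (enum_uniq 'I_d) => //= n s IH /andP[ns us].
rewrite inE mnmDE mnm1E; case: (eqVneq k n) ns => [<- ns _|kn _ ks] /=.
  rewrite addn1 iterS; congr (shiftD k (iter _ _ _)).
  elim: s ns {IH us} => //= n' s IH; rewrite inE negb_or => /andP[kn' ks].
  by rewrite (IH ks) mnmDE mnm1E (negPf kn') addn0.
by rewrite addn0 IH //; elim: (a n) => //= m ->; exact: shiftDC.
Qed.

Lemma shiftDm_commute (h : mpoly d K -> mpoly d K) a q :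
  (forall n p, h (shiftD n p) = shiftD n (h p)) ->
  h (shiftDm a q) = shiftDm a (h q).
Proof.
move=> hD; elim/mnm_ind: a => [|a k IH]; first by rewrite !shiftDm0.
by rewrite !shiftDmU hD IH.
Qed.

Lemma shiftDm_is_linear a : linear (shiftDm a).
Proof.
move=> z p q; elim/mnm_ind: a => [|a k IH]; rewrite ?shiftDm0 // !shiftDmU IH.
rewrite /shiftD mderivD mderivZ !scalerDr addrACA; congr (_ + _).
by rewrite !scalerA !(mulrC z).
Qed.

HB.instance Definition _ a :=
  GRing.isLinear.Build K (mpoly d K) (mpoly d K) _ (shiftDm a)
    (shiftDm_is_linear a).

Lemma mderivm_shiftDm a b q : mderivm b (shiftDm a q) = shiftDm a (mderivm b q).
Proof.
apply: shiftDm_commute => n p; rewrite /shiftD mderivmD !mderivmZ.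
by rewrite -!mderivmU1m -!mderivmDm addmC.
Qed.

Lemma shiftDm1 a : shiftDm a 1 = mpolyC d (meval c (mpolyX K a)).
Proof.
elim/mnm_ind: a => [|a k IH]; first by rewrite shiftDm0 mpolyX0 meval1.
rewrite shiftDmU IH /shiftD mderivC scaler0 addr0 mpolyXD mevalM mevalXU.
by rewrite mulrC mpolyCM mul_mpolyC.
Qed.

(** The commutator rule: c_n + t D_n commutes with X_m for m <> n, and its
  commutator with X_n is t. *)
Lemma shiftDmXU a n q : shiftDm a ('X_ n * q) =
  'X_ n * shiftDm a q + (t * (a n)%:R) *: shiftDm (mnm_sub a (mnm1 n)) q.
Proof.
elim/mnm_ind: a => [|a k IH]; first by rewrite !shiftDm0 mnm0E mulr0 scale0r addr0.
rewrite !shiftDmU IH [in LHS]/shiftD mderivD mderivM mderivZ mderivX.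
set r := shiftDm a q.
(* When a n = 0 the truncated subtraction a - U_n does not commute with adding
   U_k, but then the coefficient vanishes. *)
have -> : (t * (mnm_add a (mnm1 k) n)%:R) *:
      shiftDm (mnm_sub (mnm_add a (mnm1 k)) (mnm1 n)) q =
    (t * (a n)%:R) *: shiftD k (shiftDm (mnm_sub a (mnm1 n)) q) +
    (t * (k == n)%:R) *: r.
  rewrite -shiftDmU mnmDE mnm1E natrD mulrDr scalerDl; congr (_ + _).
    have [->|an] := eqVneq (a n) 0%N; first by rewrite mulr0 !scale0r.
    congr (_ *: shiftDm _ q); apply/mnmP => i; rewrite !(mnmDE, mnmBE, mnm1E).
    case: (eqVneq n i) an => [->|]; rewrite ?subn0 //.
    by case: (a i) => // m; rewrite addSn !subn1.
  case: eqVneq => [->|_]; last by rewrite mulr0 !scale0r.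
  by rewrite addmK.
rewrite mnm1E eq_sym /shiftD; case: (eqVneq k n) => [->|_] /=.
  by rewrite scale1r submm mpolyX0 -!mul_mpolyC !rmorphM /= mpolyC1; ring.
rewrite scale0r mul0r !mulr0 scale0r !add0r addr0.
by rewrite -!mul_mpolyC !rmorphM /=; ring.
Qed.

(** Each variable of X^g is moved to the left of (c + tD)^a, where it has no
  constant coefficient; what survives is the commutator, and this lowers a as
  D_n lowers X^a. *)
Lemma mcoeff0_shiftDmX a g :
  mcoeff mnm0 (shiftDm a (mpolyX K g)) =
  t ^+ mdeg g * meval c (mderivm g (mpolyX K a)).
Proof.
elim/mnm_ind: g a => [|g n IH] a.
  by rewrite mpolyX0 shiftDm1 mcoeffC eqxx mulr1 mdeg0 mul1r mderivm0m.
rewrite addmC mpolyXD shiftDmXU mcoeffD mcoeffZ IH mderivmDm mderivmU1m mderivX.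
rewrite mderivmZ mevalZ mdegD mdeg1 exprS rmorphM /= mcoeffX -mdeg_eq0 mdeg1.
by rewrite mul0r add0r mulrACA.
Qed.

Definition shiftDP p q : mpoly d K :=
  \sum_(a <- msupp p) mcoeff a p *: shiftDm a q.

Lemma shiftDP_is_linear p : linear (shiftDP p).
Proof.
move=> z q r; rewrite /shiftDP scaler_sumr -big_split /=; apply: eq_bigr => a _.
by rewrite linearP scalerDr !scalerA (mulrC z).
Qed.

HB.instance Definition _ p :=
  GRing.isLinear.Build K (mpoly d K) (mpoly d K) _ (shiftDP p)
    (shiftDP_is_linear p).

Lemma mderivm_shiftDP p b q : mderivm b (shiftDP p q) = shiftDP p (mderivm b q).
Proof.
rewrite /shiftDP raddf_sum; apply: eq_bigr => a _.
by rewrite /= mderivmZ mderivm_shiftDm.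
Qed.

Lemma mcoeff0_shiftDPX p g :
  mcoeff mnm0 (shiftDP p (mpolyX K g)) = t ^+ mdeg g * meval c (mderivm g p).
Proof.
rewrite {2}[p]mpolyE /shiftDP !raddf_sum /= mulr_sumr; apply: eq_bigr => a _.
by rewrite mcoeffZ mcoeff0_shiftDmX mderivmZ mevalZ mulrCA.
Qed.

End ShiftedDerivatives.

(** Applying D^b turns the coefficient at b, times b!, into the constant one;
  as D^b commutes with P(c + tD) and sends X^a to a!/(a - b)! X^(a - b), only
  the constant coefficient of P(c + tD) X^(a - b) is needed. Dividing by b!
  is where characteristic zero enters. *)
Lemma mcoeff_shiftDPX d (K : numDomainType) (c : 'I_d -> K) t p a b :
  mcoeff b (shiftDP c t p (mpolyX K a)) =
  if lem b a then t ^+ mdeg (mnm_sub a b) * (\prod_(i < d) 'C(a i, b i))%:R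
    * meval c (mderivm (mnm_sub a b) p) else 0.
Proof.
have b_fact : (\prod_(i < d) mnm_add b mnm0 i ^_ b i = \prod_(i < d) (b i)`!)%N.
  by apply: eq_bigr => i _; rewrite addm0 ffactnn.
have b_fact_gt0 : (0 < \prod_(i < d) (b i)`!)%N.
  by rewrite prodn_gt0 // => i; rewrite fact_gt0.
have := mcoeff_mderivm b (shiftDP c t p (mpolyX K a)) mnm0.
rewrite b_fact addm0 mderivm_shiftDP mderivmX linearZ /= mcoeffZ.
rewrite mcoeff0_shiftDPX prod_ffact_bin natrM => coef_b.
apply/eqP; rewrite -(eqr_pMn2r b_fact_gt0) -coef_b; apply/eqP.
case: ifPn => [_|/prod_bin_eq0 ->]; first by rewrite -[RHS]mulr_natr; ring.
by rewrite !mul0r mul0rn.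
Qed.

(** * Complex-valued differentiable functions *)

Section ComplexDifferential.
Variables (R : realType) (d : nat).
Local Notation C := R[i].
Local Notation V := 'rV[R]_d.
Implicit Types (f g df dg : V -> C) (x : V).

Lemma is_diff_ext (f g df dg : V -> R) x : is_diff x f df -> f =1 g -> df =1 dg ->
  is_diff x g dg.
Proof. by move=> H /funext <- /funext <-. Qed.

(** The chain rule for an outer function of one real variable. *)
Lemma is_diff_fun1 (u du : V -> R) (phi : R -> R) (dphi : R) x :
  is_diff x u du -> is_derive (u x) 1 phi dphi ->
  is_diff x (fun y => phi (u y)) (fun h => dphi * du h).
Proof.
move=> ux [pd pv].
have pdiff : differentiable phi (u x) by apply/derivable1_diffP.
have := is_diff_comp ux (differentiableP pdiff).
move=> /is_diff_ext; apply => // h /=.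
by rewrite deriv1E // derive1E pv /= mulrC.
Qed.

Lemma ReM (z w : C) : complex.Re (z * w) =
  complex.Re z * complex.Re w - complex.Im z * complex.Im w.
Proof. by case: z w => ? ? []. Qed.

Lemma ImM (z w : C) : complex.Im (z * w) =
  complex.Re z * complex.Im w + complex.Im z * complex.Re w.
Proof. by case: z w => ? ? []. Qed.

Lemma cexp_neq0 (z : C) : cexp z != 0.
Proof.
rewrite /cexp mulf_eq0 negb_or; apply/andP; split.
  by rewrite eq_complex /= negb_and expR_eq0.
rewrite eq_complex /=; apply/negP => /andP[/eqP c0 /eqP s0].
have := cos2Dsin2 (complex.Im z); rewrite c0 s0 expr0n addr0 => /eqP.
by rewrite eq_sym oner_eq0.
Qed.

(** Differentiability over the reals, split into real and imaginary parts as in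
  [partialC] and [smooth]. *)
Definition is_cdiff x f df : Prop :=
  is_diff x (fun y => complex.Re (f y)) (fun h => complex.Re (df h)) /\
  is_diff x (fun y => complex.Im (f y)) (fun h => complex.Im (df h)).

Lemma is_cdiff_eq x f df dg : is_cdiff x f df -> df =1 dg -> is_cdiff x f dg.
Proof. by move=> H /funext <-. Qed.

Lemma is_cdiff_partialC x f df n : is_cdiff x f df ->
  partialC n f x = df (delta_mx 0 n).
Proof.
move=> [fr fi]; rewrite /partialC !deriveE; try exact: ex_diff.
by rewrite !diff_val; case: (df _).
Qed.

Lemma is_cdiff_cst x (z : C) : is_cdiff x (cst z) (cst 0).
Proof. by split; apply: is_diff_cst. Qed.

Lemma is_cdiff_coord x s : is_cdiff x (fun y => (y 0 s)%:C) (fun h => (h 0 s)%:C).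
Proof.
split => /=; last exact: is_diff_cst.
have dc := @differentiable_coord R 1 d x 0 s.
apply: DiffDef => //.
have lc : linear (fun N : V => N 0 s : R) by move=> k a b; rewrite !mxE.
pose L := GRing.isLinear.Build _ _ _ _ _ lc.
pose Lf : {linear V -> R} := HB.pack (fun N : V => N 0 s : R) L.
have := @diff_lin R V R Lf x; apply; exact: coord_continuous.
Qed.

Lemma is_cdiffD x f g df dg : is_cdiff x f df -> is_cdiff x g dg ->
  is_cdiff x (fun y => f y + g y) (fun h => df h + dg h).
Proof.
move=> [fr fi] [gr gi]; split.
  by apply: is_diff_ext (is_diffD fr gr) _ _ => y; rewrite raddfD.
by apply: is_diff_ext (is_diffD fi gi) _ _ => y; rewrite raddfD.
Qed.

Lemma is_cdiffM x f g df dg : is_cdiff x f df -> is_cdiff x g dg ->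
  is_cdiff x (fun y => f y * g y) (fun h => f x * dg h + g x * df h).
Proof.
move=> [fr fi] [gr gi]; split.
  apply: is_diff_ext (is_diffB (is_diffM fr gr) (is_diffM fi gi)) _ _ => y.
    by rewrite ReM.
  rewrite [RHS]raddfD /= !ReM !fctE /GRing.scale /=; ring.
apply: is_diff_ext (is_diffD (is_diffM fr gi) (is_diffM fi gr)) _ _ => y.
  by rewrite ImM.
rewrite [RHS]raddfD /= !ImM !fctE /GRing.scale /=; ring.
Qed.

Lemma is_cdiff_cexp x f df : is_cdiff x f df ->
  is_cdiff x (fun y => cexp (f y)) (fun h => cexp (f x) * df h).
Proof.
move=> [fr fi].
have e := is_diff_fun1 fr (is_derive_expR _).
have c := is_diff_fun1 fi (is_derive_cos _).
have s := is_diff_fun1 fi (is_derive_sin _).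
split.
  apply: is_diff_ext (is_diffM e c) _ _ => y.
    by rewrite /cexp ReM /= mul0r subr0.
  rewrite /cexp !(ReM, ImM) !fctE /GRing.scale /=; ring.
apply: is_diff_ext (is_diffM e s) _ _ => y.
  by rewrite /cexp ImM /= mul0r addr0.
rewrite /cexp !(ReM, ImM) !fctE /GRing.scale /=; ring.
Qed.

Lemma is_cdiff_sum (I : Type) (r : seq I) (F dF : I -> V -> C) x :
  (forall i, is_cdiff x (F i) (dF i)) ->
  is_cdiff x (fun y => \sum_(i <- r) F i y) (fun h => \sum_(i <- r) dF i h).
Proof.
move=> H; elim: r => [|i r IH].
  under eq_fun do rewrite big_nil.
  by apply: is_cdiff_eq (is_cdiff_cst _ _) _ => h; rewrite big_nil.
under eq_fun do rewrite big_cons.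
by apply: is_cdiff_eq (is_cdiffD (H i) IH) _ => h; rewrite big_cons.
Qed.

Definition realpoint x : 'I_d -> C := fun s => (x 0 s)%:C.

Definition meval_diff (q : mpoly d C) x : V -> C := fun h =>
  \sum_(n < d) meval (realpoint x) (mderiv n q) * (h 0 n)%:C.

Lemma is_cdiff_mevalM (p q : mpoly d C) x :
  is_cdiff x (fun y => meval (realpoint y) p) (meval_diff p x) ->
  is_cdiff x (fun y => meval (realpoint y) q) (meval_diff q x) ->
  is_cdiff x (fun y => meval (realpoint y) (p * q)) (meval_diff (p * q) x).
Proof.
move=> dp dq; under eq_fun do rewrite mevalM.
apply: is_cdiff_eq (is_cdiffM dp dq) _ => h.
rewrite /meval_diff !mulr_sumr -big_split; apply: eq_bigr => n _ /=.
rewrite mderivM mevalD !mevalM; ring.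
Qed.

Lemma is_cdiff_meval (q : mpoly d C) x :
  is_cdiff x (fun y => meval (realpoint y) q) (meval_diff q x).
Proof.
have dC z : is_cdiff x (fun y => meval (realpoint y) (mpolyC d z))
    (meval_diff (mpolyC d z) x).
  under eq_fun do rewrite mevalC.
  apply: is_cdiff_eq (is_cdiff_cst _ z) _ => h.
  by rewrite /meval_diff big1 // => n _; rewrite mderivC meval0 mul0r.
elim/mpolyind: q => [|z a p _ _ dp]; first exact: dC 0.
under eq_fun do rewrite mevalD.
apply: (@is_cdiff_eq _ _ (fun h =>
    meval_diff (z *: mpolyX C a) x h + meval_diff p x h)); last first.
  move=> h; rewrite /meval_diff -big_split; apply: eq_bigr => n _ /=.
  by rewrite mderivD mevalD mulrDl.
apply: is_cdiffD dp; rewrite -mul_mpolyC; apply: is_cdiff_mevalM => //.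
elim/mnm_ind: a => [|a k IH]; first by rewrite mpolyX0; exact: dC 1.
rewrite mpolyXD; apply: is_cdiff_mevalM => //.
under eq_fun do rewrite mevalXU.
apply: is_cdiff_eq (is_cdiff_coord _ k) _ => h.
rewrite /meval_diff (bigD1 k) //= mderivX mnm1E eqxx scale1r.
rewrite submm mpolyX0 meval1 mul1r big1 ?addr0 // => n nk.
by rewrite mderivX mnm1E eq_sym (negPf nk) scale0r meval0 mul0r.
Qed.

Lemma is_cdiff_dotp (x0 : 'rV[C]_d) x :
  is_cdiff x (dotp x0) (dotp x0).
Proof.
rewrite /dotp; apply: is_cdiff_sum => s.
apply: is_cdiff_eq (is_cdiffM (is_cdiff_cst _ _) (is_cdiff_coord _ _)) _ => h.
by rewrite /= mulr0 addr0.
Qed.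

End ComplexDifferential.

(** * Exponentials times polynomials *)

Section ExpTimesPoly.
Variables (R : realType) (d : nat) (x0 : 'rV[R[i]]_d).
Local Notation C := R[i].
Local Notation V := 'rV[R]_d.
Implicit Types (p q : mpoly d C).

Definition exp_mpoly q : V -> C := fun x =>
  cexp ('i%C * dotp x0 x) * meval (realpoint x) q.

(** D_n conjugated by the multiplication by e^{i x0.x}. *)
Definition twisted_mderiv n q : mpoly d C := ('i%C * x0 0 n) *: q + mderiv n q.

Lemma is_cdiff_exp_mpoly q x :
  is_cdiff x (exp_mpoly q) (fun h => cexp ('i%C * dotp x0 x) *
    (meval_diff q x h + 'i%C * dotp x0 h * meval (realpoint x) q)).
Proof.
have dexp := is_cdiff_cexp (is_cdiffM (is_cdiff_cst x 'i%C) (is_cdiff_dotp x0 x)).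
apply: is_cdiff_eq (is_cdiffM dexp (is_cdiff_meval q x)) _ => h /=.
rewrite mulr0 addr0; ring.
Qed.

Lemma partialC_exp_mpoly n q :
  partialC n (exp_mpoly q) = exp_mpoly (twisted_mderiv n q).
Proof.
apply/funext => x; rewrite (is_cdiff_partialC _ (is_cdiff_exp_mpoly q x)).
rewrite /exp_mpoly /twisted_mderiv mevalD mevalZ; congr (_ * _); rewrite addrC.
have sum_delta (F : 'I_d -> C) :
    \sum_(s < d) F s * ((delta_mx 0 n : V) 0 s)%:C = F n.
  rewrite (bigD1 n) //= mxE !eqxx mulr1 big1 ?addr0 // => s sn.
  by rewrite mxE (negPf sn) andbF mulr0.
by rewrite /meval_diff /dotp !sum_delta.
Qed.

Lemma smooth_exp_mpoly q : smooth (exp_mpoly q).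
Proof.
move=> s x; suff [p -> /=] : exists p,
    foldr (@partialC R d) (exp_mpoly q) s = exp_mpoly p.
  by have [pr pi] := is_cdiff_exp_mpoly p x; split; exact: ex_diff.
elim: s => [|n s [p /= ->]]; first by exists q.
by exists (twisted_mderiv n p); rewrite partialC_exp_mpoly.
Qed.

(** If f_q = 0 then f_(D_n q) = D_n f_q - i x0_n f_q = 0. So f_p = 0 for
  each iterated derivative p of q, hence p(0) = 0; up to factorials these values
  are the coefficients of q. *)
Lemma exp_mpoly_eq0 q : exp_mpoly q = cst 0 -> q = 0.
Proof.
have partial0 p n : exp_mpoly p = cst 0 -> exp_mpoly (mderiv n p) = cst 0.
  move=> p0; have := partialC_exp_mpoly n p; rewrite p0.
  rewrite (_ : partialC n _ = cst 0); last first.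
    by apply/funext => x; rewrite (is_cdiff_partialC n (is_cdiff_cst x 0)).
  move=> /esym dp0; apply/funext => x.
  have := congr1 (@^~ x) dp0; have := congr1 (@^~ x) p0.
  rewrite /exp_mpoly /twisted_mderiv mevalD mevalZ /= mulrDr mulrCA => ->.
  by rewrite mulr0 add0r.
move=> q0; apply/mpolyP => a; rewrite mcoeff0.
have : exp_mpoly (mderivm a q) = cst 0.
  elim/mnm_ind: a => [|a n IH]; first by rewrite mderivm0m.
  by rewrite mderivmDm mderivmU1m; exact: partial0.
move=> /(congr1 (@^~ 0)) /= /eqP; rewrite mulf_eq0 (negPf (cexp_neq0 _)) /=.
rewrite meval_at0 => [|s]; last by rewrite /realpoint mxE.
rewrite mcoeff_mderivm addm0 mulrn_eq0 => /orP[|/eqP //].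
by rewrite -[_ == 0%N]negbK -lt0n prodn_gt0 // => i; rewrite ffactnn fact_gt0.
Qed.

Lemma minus_iD_exp_mpoly n q :
  minus_iD n (exp_mpoly q) = exp_mpoly (shiftD (x0 0) (- 'i%C) n q).
Proof.
apply/funext => x; rewrite /minus_iD partialC_exp_mpoly.
rewrite /exp_mpoly /twisted_mderiv /shiftD.
have ii : 'i%C * 'i%C = -1 :> C by rewrite -expr2 sqr_i.
rewrite !mevalD !mevalZ mulrCA; congr (_ * _).
by rewrite mulrDr !mulrA mulNr ii opprK mul1r.
Qed.

Lemma minus_iD_monomial_exp_mpoly a q :
  minus_iD_monomial a (exp_mpoly q) = exp_mpoly (shiftDm (x0 0) (- 'i%C) a q).
Proof.
rewrite /minus_iD_monomial /shiftDm; elim: (enum _) => //= n s ->.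
by elim: (a n) => //= m ->; rewrite minus_iD_exp_mpoly.
Qed.

Lemma P_minus_iD_exp_mpoly p q :
  P_minus_iD p (exp_mpoly q) = exp_mpoly (shiftDP (x0 0) (- 'i%C) p q).
Proof.
apply/funext => x; rewrite /P_minus_iD /exp_mpoly /shiftDP raddf_sum mulr_sumr.
by apply: eq_bigr => a _; rewrite minus_iD_monomial_exp_mpoly /= mevalZ mulrCA.
Qed.

Lemma ker_P_minus_iD_exp_mpoly p q :
  ker_P_minus_iD p (exp_mpoly q) <-> shiftDP (x0 0) (- 'i%C) p q = 0.
Proof.
rewrite /ker_P_minus_iD /= P_minus_iD_exp_mpoly; split=> [[_ /exp_mpoly_eq0 //]|->].
split; first exact: smooth_exp_mpoly.
by apply/funext => x; rewrite /exp_mpoly meval0 mulr0.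
Qed.

End ExpTimesPoly.

(** * Coefficient vectors and the matrix of P(x0 - iD) *)

Section CoefficientVector.
Variables (R : realType) (d : nat) (l : nat).
Hypothesis d_gt0 : (0 < d)%N.
Local Notation C := R[i].
Implicit Types (v : 'cV[C]_(tdim d l)).

Lemma uniq_multi_indices_upto : uniq (multi_indices_upto d l).
Proof.
rewrite /multi_indices_upto.
elim: (iota _ _) (iota_uniq 0 l.+1) => //= k s IH /andP[ks us].
rewrite cat_uniq uniq_multi_indices IH // andbT.
apply/hasPn => a /flatten_mapP[k' k's]; rewrite mem_multi_indices => /eqP ak'.
by rewrite /= mem_multi_indices; apply: contraNneq ks => <-; rewrite ak'.
Qed.

Lemma multi_index_inj : injective (@multi_index d l).
Proof.
move=> j k /eqP; rewrite /multi_index nth_uniq ?size_multi_indices_upto //.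
  by move/eqP/val_inj.
exact: uniq_multi_indices_upto.
Qed.

Lemma mdeg_multi_index (j : 'I_(tdim d l)) : (mdeg (multi_index j) <= l)%N.
Proof. by rewrite -mem_multi_indices_upto mem_nth // size_multi_indices_upto. Qed.

Lemma multi_indexP (a : multinom d) : (mdeg a <= l)%N ->
  exists j : 'I_(tdim d l), a = multi_index j.
Proof.
rewrite -mem_multi_indices_upto => al.
have jlt : (index a (multi_indices_upto d l) < tdim d l)%N.
  by rewrite -size_multi_indices_upto // index_mem.
by exists (Ordinal jlt); rewrite /multi_index /= nth_index.
Qed.

Definition mpoly_of v : mpoly d C := \sum_j v j 0 *: mpolyX C (multi_index j).

Lemma exp_poly_mpoly_of x0 v : exp_poly x0 v = exp_mpoly x0 (mpoly_of v).
Proof.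
apply/funext => x; rewrite /exp_poly /exp_mpoly /mpoly_of; congr (_ * _).
rewrite mxE (raddf_sum (meval _)); apply: eq_bigr => j _ /=.
by rewrite mevalZ mevalX mxE mulrC.
Qed.

Lemma mcoeff_shiftDP_mpoly_of P (x0 : 'rV[C]_d) v b :
  mcoeff b (shiftDP (x0 0) (- 'i%C) P (mpoly_of v)) =
  \sum_k (let a := multi_index k in
    if lem b a then
      (- 'i%C) ^+ mdeg (mnm_sub a b) * (\prod_(s < d) 'C(a s, b s))%:R
        * peval (mderivm (mnm_sub a b) P) x0
    else 0) * v k 0.
Proof.
rewrite /mpoly_of (raddf_sum (shiftDP (x0 0) (- 'i%C) P)) (raddf_sum (mcoeff b)).
apply: eq_bigr => k _ /=.
by rewrite linearZ /= mcoeffZ mcoeff_shiftDPX mulrC.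
Qed.

(** The rows of Dtilde give the coefficients up to degree l. Those beyond vanish
  since P(x0 - iD) does not raise the degree. *)
Lemma shiftDP_eq0_Dtilde P (x0 : 'rV[C]_d) v :
  shiftDP (x0 0) (- 'i%C) P (mpoly_of v) = 0 <-> Dtilde l P x0 *m v = 0.
Proof.
have entry j : (Dtilde l P x0 *m v) j 0 =
    mcoeff (multi_index j) (shiftDP (x0 0) (- 'i%C) P (mpoly_of v)).
  by rewrite mcoeff_shiftDP_mpoly_of mxE; apply: eq_bigr => k _; rewrite mxE.
split=> [q0|Dv0]; first by apply/colP => j; rewrite entry q0 mcoeff0 mxE.
apply/mpolyP => b; rewrite mcoeff0; have [bl|lb] := leqP (mdeg b) l.
  by have [j ->] := multi_indexP bl; rewrite -entry Dv0 mxE.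
rewrite mcoeff_shiftDP_mpoly_of big1 // => k _ /=; case: ifP => [/mdeg_lem bk|_].
  by have := leq_trans lb (leq_trans bk (mdeg_multi_index k)); rewrite ltnn.
by rewrite mul0r.
Qed.

(** A row of Dtilde has non-zero entries only at multi-indices above its own. If
  the latter has maximal degree in the support of v, only the diagonal entry,
  which is P(x0), meets a non-zero coordinate of v. *)
Lemma Dtilde_ker_root P (x0 : 'rV[C]_d) v :
  v != 0 -> Dtilde l P x0 *m v = 0 -> peval P x0 = 0.
Proof.
move=> v0 Dv0.
have [j vj] : exists j, v j 0 != 0.
  apply/existsP; apply: contraNT v0; rewrite negb_exists => /forallP vj0.
  by apply/eqP/colP => j; rewrite mxE; apply/eqP/negPn.
case: (@arg_maxnP _ j (fun j => v j 0 != 0) (fun j => mdeg (multi_index j)) vj).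
move=> {vj} m vm mmax; have := congr1 (fun A : 'cV_(tdim d l) => A m 0) Dv0.
rewrite !mxE (bigD1 m) //= big1 => [|k km].
  rewrite addr0 mxE /= lepm_refl submm mdeg0 expr0 mul1r mderivm0m.
  rewrite big1 => [|s _]; last exact: binn.
  by rewrite mul1r => /eqP; rewrite mulf_eq0 (negPf vm) orbF => /eqP.
rewrite mxE /=; case: ifP => [mk|_]; last by rewrite mul0r.
have [->|vk] := eqVneq (v k 0) 0; first by rewrite mulr0.
by case/eqP: km; apply/multi_index_inj/(lem_mdeg_eq mk); exact: mmax vk.
Qed.

End CoefficientVector.

Theorem theorem4p1 (R : realType) (d : nat) (hd : (0 < d)%N)
    (P : mpoly d R[i]) (x0 : 'rV[R[i]]_d) (l : nat)
    (v : 'cV[R[i]]_(tdim d l)) (hv : exp_poly x0 v <> cst 0) :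
  ker_P_minus_iD P (exp_poly x0 v) <->
  peval P x0 = 0 /\ Dtilde l P x0 *m v = 0.
Proof.
have v0 : v != 0.
  apply/eqP => v0; apply: hv; rewrite v0; apply/funext => x.
  by rewrite /exp_poly mulmx0 mxE mulr0.
rewrite exp_poly_mpoly_of ker_P_minus_iD_exp_mpoly shiftDP_eq0_Dtilde //.
split=> [Dv0|[]//]; split=> //; exact: Dtilde_ker_root Dv0.
Qed.
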